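(* Let $n\ge 1$, let $S=(a_{ij})_{1\le i,j\le n}$ be the generic noncommutative stochastic matrix, let $\mathcal S$ be the stochastic free field, and let $\mathcal F$ be the free field on the noncommuting variables $a_{ij}$. Let $C_i,P_i\in\mathbb Q\langle\langle a_{ij}\rangle\rangle$ ($1\le i\le n$) be the path series defined in the context, viewed as elements of $\mathcal F$. Let $\lambda$ be the unique derivation of $\mathcal F$ with $\lambda(a_{ij})=a_{ij}$ for all $i,j$. Then the elements $P_i$ can be evaluated in $\mathcal S$, their values are nonzero (the values are still denoted $P_i$), and $(P_1^{-1},\dots,P_n^{-1})$ is a left eigenvector of $S$ for the eigenvalue $1$, i.e. $(P_1^{-1},\dots,P_n^{-1})\,S=(P_1^{-1},\dots,P_n^{-1})$ in $\mathcal S$. Moreover, in $\mathcal S$: (i) $\sum_{i=1}^n P_i^{-1}=1$; (ii) for every $i$, $C_i$ can be evaluated in $\mathcal S$ and is equal to $1$; (iii) for every $i$, $\lambda(C_i)$ can be evaluated in $\mathcal S$ and is equal to $P_i$.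
   Context: Free field: for a set $X$ of noncommuting variables, the free field is the (unique up to isomorphism) skew field $\mathcal F\supseteq\mathbb Q\langle X\rangle$, generated as a skew field by the free associative algebra $\mathbb Q\langle X\rangle$, such that for each $\mathbb Q$-algebra homomorphism $\mu:\mathbb Q\langle X\rangle\to D$ into a skew field $D$ there are a subalgebra $O_\mu$ with $\mathbb Q\langle X\rangle\subseteq O_\mu\subseteq\mathcal F$ and a homomorphism $\overline\mu:O_\mu\to D$ extending $\mu$ such that $f\in O_\mu$, $\overline\mu(f)\ne0$ imply $f^{-1}\in O_\mu$. Generic matrices: $M=(a_{ij})_{1\le i,j\le n}$ is the matrix of $n^2$ noncommuting variables, and $\mathcal F$ is the free field of $\mathbb Q\langle a_{ij}\rangle$. The stochastic identities are $\sum_{j=1}^n a_{ij}=1$ for $i=1,\dots,n$. The quotient of $\mathbb Q\langle a_{ij}\rangle$ by the two-sided ideal generated by these identities is isomorphic to the free associative algebra $\mathbb Q\langle a_{ij}, i\ne j\rangle$ (eliminate the $a_{ii}$). Its free field is the stochastic free field $\mathcal S$. The image of $M$ over $\mathcal S$ is $S$, the generic noncommutative stochastic matrix. Rational series and evaluation: a series in $\mathbb Q\langle\langle a_{ij}\rangle\rangle$ is rational if it has a $*$-rational expression, i.e. a well-formed expression in scalars, letters, sums, products and the star $T\mapsto T^*=\sum_{m\ge0}T^m=(1-T)^{-1}$ applied to series $T$ with zero constant term. Replacing each $T^*$ by $(1-T)^{-1}$ gives a rational expression (sums, products, inverses) over $\mathbb Q\langle a_{ij}\rangle$. This defines a canonical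 embedding of the ring of rational series into $\mathcal F$. An element of $\mathcal F$ can be evaluated in $\mathcal S$ if it is given by a rational expression over $\mathbb Q\langle a_{ij}\rangle$ which can be computed in $\mathcal S$ (with the $a_{ij}$ replaced by their images in $\mathcal S$) without ever inverting $0$. Its value in $\mathcal S$ does not depend on the choice of such an expression. Path series: in the complete directed graph on $\{1,\dots,n\}$ (loops included), the path $i_0\to i_1\to\dots\to i_s$ is identified with the word $a_{i_0i_1}a_{i_1i_2}\cdots a_{i_{s-1}i_s}$ (the empty path with $1$). $C_i$ is the sum of all nonempty paths from $i$ to $i$ having no intermediate visit to $i$. $P_i$ is the sum of all paths (including the empty path) starting at $i$, ending at any vertex, and not passing through $i$ again. Both are rational series. *)

(* Defs.v *)
From HB Require Import structures.
From mathcomp Require Import all_boot all_algebra.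
From mathcomp Require Import classical_sets.
From mathcomp.multinomials Require Import monalg.

Set Implicit Arguments.
Unset Strict Implicit.
Unset Printing Implicit Defensive.

Import GRing.Theory.
Local Open Scope ring_scope.

Definition freealg (X : choiceType) := {malg rat[{fmonom X}]}.

Definition var (X : choiceType) (x : X) : freealg X := << fmu x >>.

(* The algebra morphism out of Q<X> sending each letter x to h x. *)
Definition substitute (X : choiceType) (A : lalgType rat) (h : X -> A) :
    freealg X -> A :=
  mmap (fun c : rat => c%:A) (fun w : {fmonom X} => \prod_(x <- w) h x).

Definition skew_field (D : unitRingType) : Prop :=
  forall x : D, x != 0 -> x \is a GRing.unit.

Section FreeField.
Variables (X : choiceType) (F : unitAlgType rat).
Variable iota : {lrmorphism freealg X -> F}.

Definition generates_as_skew_field : Prop :=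
  forall K : {pred F}, GRing.divring_closed K ->
    (forall p, iota p \in K) -> forall f, f \in K.

(* [nu] stands for a homomorphism O -> D; its values outside O are
   irrelevant. *)
Definition extends_to (D : unitAlgType rat) (mu : {lrmorphism freealg X -> D})
    (O : {pred F}) (nu : F -> D) : Prop :=
  [/\ GRing.subalg_closed O,
      forall p, iota p \in O /\ nu (iota p) = mu p,
      {in O &, {morph nu : f g / f + g}} /\ {in O &, {morph nu : f g / f * g}},
      forall c : rat, {in O, {morph nu : f / c *: f}} &
      forall f, f \in O -> nu f != 0 -> f^-1 \in O].

Definition is_free_field : Prop :=
  [/\ skew_field F, injective iota, generates_as_skew_field &
      forall (D : unitAlgType rat) (mu : {lrmorphism freealg X -> D}),
        skew_field D -> exists (O : {pred F}) (nu : F -> D),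
          extends_to mu O nu].

End FreeField.

Inductive rexpr (X : choiceType) : Type :=
| RPoly of freealg X
| RAdd of rexpr X & rexpr X
| RMul of rexpr X & rexpr X
| RInv of rexpr X.

(* [computes g e x]: with the elements of Q<X> replaced by their images
   under g, e can be computed in D without ever inverting 0, and yields x. *)
Inductive computes (X : choiceType) (D : unitRingType) (g : freealg X -> D) :
    rexpr X -> D -> Prop :=
| ComputesPoly p : computes g (RPoly p) (g p)
| ComputesAdd e1 e2 x1 x2 : computes g e1 x1 -> computes g e2 x2 ->
    computes g (RAdd e1 e2) (x1 + x2)
| ComputesMul e1 e2 x1 x2 : computes g e1 x1 -> computes g e2 x2 ->
    computes g (RMul e1 e2) (x1 * x2)
| ComputesInv e x : computes g e x -> x != 0 -> computes g (RInv e) x^-1.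

(* A noncommutative formal power series is its coefficient function. *)
Definition series (X : choiceType) := seq X -> rat.

Section Series.
Variable X : choiceType.
Implicit Types s t : series X.

Definition series_const (c : rat) : series X := fun w => c *+ (w == [::]).

Definition series_var (x : X) : series X := fun w => (w == [:: x])%:R.

Definition series_add s t : series X := fun w => s w + t w.

Definition series_mul s t : series X :=
  fun w => \sum_(k < (size w).+1) s (take k w) * t (drop k w).

Definition series_exp s (m : nat) : series X :=
  iter m (series_mul s) (series_const 1).

(* When s has zero constant term, s^m has no word of length < m in its
   support, so that truncating the sum at m = size w loses nothing. *)
Definition series_star s : series X :=
  fun w => \sum_(m < (size w).+1) series_exp s m w.

End Series.

Inductive star_expr (X : choiceType) : Type :=
| SConst of rat
| SVar of X
| SAdd of star_expr X & star_expr X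
| SMul of star_expr X & star_expr X
| SStar of star_expr X.

Arguments SConst {X}.

Section StarExpressions.
Variable X : choiceType.

Fixpoint star_series (e : star_expr X) : series X :=
  match e with
  | SConst c => series_const c
  | SVar x => series_var x
  | SAdd e1 e2 => series_add (star_series e1) (star_series e2)
  | SMul e1 e2 => series_mul (star_series e1) (star_series e2)
  | SStar e1 => series_star (star_series e1)
  end.

Fixpoint well_formed (e : star_expr X) : bool :=
  match e with
  | SConst _ | SVar _ => true
  | SAdd e1 e2 | SMul e1 e2 => well_formed e1 && well_formed e2
  | SStar e1 => well_formed e1 && (star_series e1 [::] == 0)
  end.

Fixpoint star_rexpr (e : star_expr X) : rexpr X :=
  match e with
  | SConst c => RPoly (c%:A : freealg X)
  | SVar x => RPoly (var x)
  | SAdd e1 e2 => RAdd (star_rexpr e1) (star_rexpr e2)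
  | SMul e1 e2 => RMul (star_rexpr e1) (star_rexpr e2)
  | SStar e1 => RInv (RAdd (RPoly 1) (RMul (RPoly (- 1)) (star_rexpr e1)))
  end.

(* The graph of the canonical embedding of rational series into F. *)
Definition series_image (F : unitAlgType rat)
    (iota : {lrmorphism freealg X -> F}) (s : series X) (f : F) : Prop :=
  exists e : star_expr X,
    [/\ well_formed e, star_series e =1 s & computes iota (star_rexpr e) f].

(* The canonical embedding; the junk value 0 is taken when s is not rational. *)
Definition embed_series (F : unitAlgType rat)
    (iota : {lrmorphism freealg X -> F}) (s : series X) : F :=
  xget 0 (series_image iota s).

End StarExpressions.

Section Evaluation.
Variables (X : choiceType) (F S : unitRingType).
Variables (iota : freealg X -> F) (sigma : freealg X -> S).

Definition evaluates_to (f : F) (v : S) : Prop :=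
  exists e : rexpr X, computes iota e f /\ computes sigma e v.

Definition evaluable (f : F) : Prop := exists v, evaluates_to f v.

(* The value of f in S, with junk value 0 when f is not evaluable. *)
Definition value (f : F) : S := xget 0 (evaluates_to f).

End Evaluation.

Section StochasticMatrix.
Variable n : nat.

Definition letter : choiceType := ('I_n * 'I_n)%type.

Definition offdiag_letter : choiceType := {p : 'I_n * 'I_n | p.1 != p.2}.

Definition a (i j : 'I_n) : freealg letter := var ((i, j) : letter).

(* The image of a_ij in the quotient of Q<a_ij> by the stochastic identities,
   identified with Q<a_ij, i != j> by eliminating the a_ii. *)
Definition stoch_offdiag (p : 'I_n * 'I_n) : freealg offdiag_letter :=
  if insub p is Some q then var (q : offdiag_letter) else 0.

Definition stoch_letter (p : letter) : freealg offdiag_letter :=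
  if p.1 == p.2 then 1 - \sum_(j < n | j != p.1) stoch_offdiag (p.1, j)
  else stoch_offdiag p.

Definition stoch : freealg letter -> freealg offdiag_letter :=
  substitute stoch_letter.

(* The word of the path i -> i1 -> ... -> is, where s = [:: i1; ...; is]. *)
Definition path_word (i : 'I_n) (s : seq 'I_n) : seq letter := pairmap pair i s.

(* If w is the word of a path i0 -> ... -> is then unzip2 w is i1, ..., is,
   and behead (belast _ _) drops i0 and is from it. *)
Definition C_series (i : 'I_n) : series letter := fun w =>
  let s := unzip2 w in
  [&& w == path_word i s, s != [::], last i s == i &
      i \notin behead (belast i s)]%:R.

Definition P_series (i : 'I_n) : series letter := fun w =>
  let s := unzip2 w in [&& w == path_word i s & i \notin s]%:R.

End StochasticMatrix.

Definition derivation (F : unitRingType) (d : F -> F) : Prop :=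
  (forall x y, d (x + y) = d x + d y) /\
  (forall x y, d (x * y) = d x * y + x * d y).

(* Main.v *)
(* Let K_L(p, q) be the sum of the nonempty paths from p to q whose intermediate
   vertices lie in L.  Kleene's recursion
     K_{r,L}(p, q) = K_L(p, q) + K_L(p, r) (1 - K_L(r, r))^-1 K_L(r, q)
   gives *-rational expressions for these series, and with L the set of all
   vertices but i, C_i = K_L(i, i) and P_i = 1 + sum_{k in L} K_L(i, k).  In a
   ring where the rows of (a_ij) sum to 1 and the pivots 1 - K_L(r, r) are
   invertible, induction on L gives sum_{q notin L} K_L(p, q) = 1, whence
   C_i = 1; sum_{q notin L} lambda(K_L(p, q)) = 1 + sum_{k in L} K_L(p, k), whence
   lambda(C_i) = P_i; and, for every row vector z with z (a_ij) = z,
   z_q = sum_{p notin L} z_p K_L(p, q).  So z_q = z_i K_L(i, q) when L omits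
   only i: the fixed row vectors (K_L(i, q))_q, whose entries add up to P_i, are
   left multiples of each other, which forces the i-th entry of the normalized
   one to be P_i^-1.

   That no pivot vanishes in the stochastic free field is seen by specializing
   all a_ij to 1/n, where K_L(p, q) becomes 1/(n - |L|).

   A *-rational expression of the series 0 has value 0 in the free field: its
   value lies in a finite-dimensional rational subspace V of F such that
   V is contained in sum_x x V, and the x lie in the maximal ideal of the local
   ring of the specialization x |-> 0, so that V = 0 by Nakayama's lemma.  Hence
   the embedding of rational series is well defined. *)

From HB Require Import structures.
Require Import Defs.
From mathcomp Require Import all_boot all_algebra.
From mathcomp Require Import boolp classical_sets.
From mathcomp Require Import ring.
From mathcomp.multinomials Require Import monalg.

Set Implicit Arguments.
Unset Strict Implicit.
Unset Printing Implicit Defensive.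

Import GRing.Theory.
Local Open Scope ring_scope.

(** * Substitution of letters as an algebra morphism *)

Section Substitution.
Variables (X : choiceType) (A : algType rat) (h : X -> A).

Definition word_value (w : {fmonom X}) : A := \prod_(x <- w) h x.

Lemma word_value_mmorphism : mmorphism word_value.
Proof.
by split=> [v w|]; rewrite /word_value ?fmM ?big_cat //= fm1 big_nil.
Qed.

HB.instance Definition _ :=
  isMultiplicative.Build {fmonom X} A word_value word_value_mmorphism.

Lemma substitute_comm (p : freealg X) u v :
  GRing.comm (in_alg A p@_u) (word_value v).
Proof. by rewrite /GRing.comm mulr_algl mulr_algr. Qed.

Lemma substitute_zmod_morphism : zmod_morphism (substitute h).
Proof. exact: (@mmap_is_additive _ _ _ (in_alg A) word_value). Qed.

Lemma substitute_monoid_morphism : monoid_morphism (substitute h).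
Proof.
have [hM h1] := commr_mmap_is_multiplicative substitute_comm.
by split; [exact: h1 | exact: hM].
Qed.

Lemma substitute_scalable : scalable (substitute h).
Proof.
move=> c p; have := @mmapZ _ _ _ (in_alg A) word_value c p.
by rewrite /= mulr_algl.
Qed.

HB.instance Definition _ :=
  GRing.isZmodMorphism.Build (freealg X) A (substitute h)
    substitute_zmod_morphism.
HB.instance Definition _ :=
  GRing.isMonoidMorphism.Build (freealg X) A (substitute h)
    substitute_monoid_morphism.
HB.instance Definition _ :=
  GRing.isScalable.Build rat (freealg X) A *:%R (substitute h)
    substitute_scalable.

Lemma substitute_var x : substitute h (var x) = h x.
Proof.
rewrite [LHS](@mmapU _ _ _ (in_alg A) word_value) /word_value fmU big_seq1.
by rewrite /= scale1r mul1r.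
Qed.

End Substitution.

(** * Star-rational series and their values in the free field *)

Section SeriesCalculus.
Variable X : choiceType.
Implicit Types (s t u : series X) (x : X) (w : seq X).

(** The left quotient [x^-1 s]. *)
Definition lquo x s : series X := fun w => s (x :: w).

Lemma series_mul_nil s t : series_mul s t [::] = s [::] * t [::].
Proof. by rewrite /series_mul big_ord1. Qed.

Lemma series_mul_cons s t x w :
  series_mul s t (x :: w) = series_mul (lquo x s) t w + s [::] * t (x :: w).
Proof. by rewrite /series_mul big_ord_recl addrC. Qed.

Lemma eq_series_mul s s' t t' :
  s =1 s' -> t =1 t' -> series_mul s t =1 series_mul s' t'.
Proof. by move=> es et w; apply: eq_bigr => k _; rewrite es et. Qed.

Lemma series_mulDl s t u w :
  series_mul (series_add s t) u w = series_mul s u w + series_mul t u w.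
Proof. by rewrite -big_split; apply: eq_bigr => k _; rewrite mulrDl. Qed.

Lemma series_mulZl c s t w :
  series_mul (fun v => c * s v) t w = c * series_mul s t w.
Proof. by rewrite mulr_sumr; apply: eq_bigr => k _; rewrite mulrA. Qed.

Lemma series_mul0l s w : series_mul (fun=> 0) s w = 0.
Proof. by apply: big1 => k _; rewrite mul0r. Qed.

Lemma series_mulA s t u w :
  series_mul s (series_mul t u) w = series_mul (series_mul s t) u w.
Proof.
elim: w s t u => [|x w IHw] s t u; first by rewrite !series_mul_nil mulrA.
rewrite !series_mul_cons IHw series_mul_nil mulrDr addrA mulrA.
congr (_ + _); rewrite -series_mulZl -series_mulDl.
by apply: eq_series_mul => // v; rewrite /lquo series_mul_cons.
Qed.

Lemma series_mul1l c s w : series_mul (series_const c) s w = c * s w.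
Proof.
case: w => [|x w]; rewrite ?series_mul_nil ?series_mul_cons //.
by rewrite series_mul0l add0r.
Qed.

Lemma series_exp_small s m w :
  s [::] = 0 -> (size w < m)%N -> series_exp s m w = 0.
Proof.
move=> s0; elim: m w => // m IHm [_|x w] /=.
  by rewrite series_mul_nil s0 mul0r.
rewrite ltnS => lt_wm; rewrite series_mul_cons s0 mul0r addr0.
apply: big1 => k _; rewrite IHm ?mulr0 // size_drop.
exact: leq_ltn_trans (leq_subr _ _) lt_wm.
Qed.

Lemma series_star_nil s : series_star s [::] = 1.
Proof. by rewrite /series_star big_ord1. Qed.

Lemma series_star_cons s x w : s [::] = 0 ->
  series_star s (x :: w) = series_mul (lquo x s) (series_star s) w.
Proof.
move=> s0; rewrite /series_star big_ord_recl /= {1}/series_const mulr0n add0r.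
under eq_bigr => m _ do rewrite series_mul_cons s0 mul0r addr0.
rewrite exchange_big; apply: eq_bigr => k _ /=.
rewrite -mulr_sumr; congr (_ * _); rewrite size_drop.
rewrite -(big_mkord xpredT (fun m => series_exp s m (drop k w))).
(* The outer sum stops at exponent [size w], whereas the star at [drop k w] already stops at
   [size w - k]; the surplus powers vanish on that word. *)
rewrite (big_cat_nat _ (n := (size w - k).+1)) ?ltnS ?leq_subr //=.
rewrite [X in _ + X]big_nat [X in _ + X]big1 ?addr0 ?big_mkord //.
by move=> m /andP[lt_m _]; rewrite series_exp_small // size_drop.
Qed.

Lemma series_starE s w : s [::] = 0 ->
  series_star s w = series_const 1 w + series_mul s (series_star s) w.
Proof.
move=> s0; case: w => [|x w].
  by rewrite series_star_nil series_mul_nil s0 mul0r addr0.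
by rewrite series_star_cons // series_mul_cons s0 mul0r addr0 add0r.
Qed.

End SeriesCalculus.

(** * Places between skew fields and Nakayama's lemma *)

Section Places.
Variables (F D : unitAlgType rat) (O : {pred F}) (nu : F -> D).

(** The partial homomorphisms of the universal property, detached from the free algebra. Between
    skew fields, [O] is a local ring with maximal ideal the kernel of [nu]. *)
Definition place :=
  [/\ GRing.subalg_closed O, nu 1 = 1,
      {in O &, {morph nu : f g / f + g}} /\ {in O &, {morph nu : f g / f * g}},
      forall c : rat, {in O, {morph nu : f / c *: f}} &
      forall f, f \in O -> nu f != 0 -> f^-1 \in O].

Lemma extends_to_place (X : choiceType) (iota : {lrmorphism freealg X -> F})
    (mu : {lrmorphism freealg X -> D}) : extends_to iota mu O nu -> place.
Proof.
by case=> OA Omu [nuD nuM] nuZ OV; split=> //; rewrite -(rmorph1 iota) (Omu 1).2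
  rmorph1.
Qed.

Hypotheses (skewF : skew_field F) (skewD : skew_field D) (plO : place).

Let OA : GRing.subalg_closed O. Proof. by case: plO. Qed.

Lemma place_1 : 1 \in O. Proof. by case: OA. Qed.

Lemma place_comb c f g : f \in O -> g \in O -> c *: f + g \in O.
Proof. by case: OA => _ h _; apply: h. Qed.

Lemma place_M f g : f \in O -> g \in O -> f * g \in O.
Proof. by case: OA => _ _; apply. Qed.

Lemma place_0 : 0 \in O.
Proof. by have := place_comb (-1) place_1 place_1; rewrite scaleN1r addNr. Qed.

Lemma place_Z c f : f \in O -> c *: f \in O.
Proof. by move=> Of; rewrite -[_ *: _]addr0 place_comb ?place_0. Qed.

Lemma place_D f g : f \in O -> g \in O -> f + g \in O.
Proof. by rewrite -[f in f + _]scale1r; apply: place_comb. Qed.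

Lemma place_N f : f \in O -> - f \in O.
Proof. by rewrite -scaleN1r; apply: place_Z. Qed.

Lemma place_V f : f \in O -> nu f != 0 -> f^-1 \in O.
Proof. by case: plO => _ _ _ _; apply. Qed.

Lemma nu1 : nu 1 = 1. Proof. by case: plO. Qed.

Lemma nuD : {in O &, {morph nu : f g / f + g}}.
Proof. by case: plO => _ _ []. Qed.

Lemma nuM : {in O &, {morph nu : f g / f * g}}.
Proof. by case: plO => _ _ []. Qed.

Lemma nuZ c : {in O, {morph nu : f / c *: f}}.
Proof. by case: plO. Qed.

Lemma nuN : {in O, {morph nu : f / - f}}.
Proof. by move=> f Of; rewrite -scaleN1r nuZ // scaleN1r. Qed.

Lemma nu0 : nu 0 = 0.
Proof. by rewrite -(scale0r 1) nuZ ?place_1 // scale0r. Qed.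

Lemma place_neq0 f : f \in O -> nu f != 0 -> f != 0.
Proof. by move=> Of; apply: contra_neq => ->; rewrite nu0. Qed.

Lemma place_unit f : f \in O -> nu f != 0 -> f \is a GRing.unit.
Proof. by move=> Of nz; apply: skewF; apply: place_neq0 nz. Qed.

Lemma nuV f : f \in O -> nu f != 0 -> nu f^-1 = (nu f)^-1.
Proof.
move=> Of nz; apply: (mulIr (skewD nz)); rewrite mulVr; last exact: skewD.
by rewrite -nuM ?place_V // mulVr ?nu1 // place_unit.
Qed.

Definition in_max f := f \in O /\ nu f = 0.

Lemma in_max_0 : in_max 0. Proof. by split; [exact: place_0|exact: nu0]. Qed.

Lemma in_max_D f g : in_max f -> in_max g -> in_max (f + g).
Proof.
by move=> [Of f0] [Og g0]; split; [exact: place_D|rewrite nuD // f0 g0 addr0].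
Qed.

Lemma in_max_M f g : f \in O -> in_max g -> in_max (f * g).
Proof.
by move=> Of [Og g0]; split; [exact: place_M|rewrite nuM // g0 mulr0].
Qed.

Lemma in_max_Mr f g : in_max f -> g \in O -> in_max (f * g).
Proof.
by move=> [Of f0] Og; split; [exact: place_M|rewrite nuM // f0 mul0r].
Qed.

Lemma nu_1B f : in_max f -> 1 - f \in O /\ nu (1 - f) = 1.
Proof.
move=> [Of f0]; split; first by rewrite place_D ?place_N ?place_1.
by rewrite nuD ?place_N ?place_1 // nuN // nu1 f0 subr0.
Qed.

(** Gaussian elimination: the coefficient [u] of the first unknown in its own equation is in the
    maximal ideal, so [1 - u] is invertible in [O]. Solving for this unknown and substituting keeps
    all coefficients in the maximal ideal. The [f i] themselves may lie outside [O]. *)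
Lemma nakayama r (f : 'I_r -> F) :
  (forall i, exists M : 'I_r -> F,
     (forall j, in_max (M j)) /\ f i = \sum_j M j * f j) ->
  forall i, f i = 0.
Proof.
elim: r f => [f _ []//|r IHr f fM].
have [M0 [M0m]] := fM ord0; rewrite big_ord_recl; set u := M0 ord0 => f0E.
have [Ou nu_u] := nu_1B (M0m ord0).
have nz_u : nu (1 - u) != 0 by rewrite nu_u oner_eq0.
have {}f0E : f ord0 = \sum_j (1 - u)^-1 * M0 (lift ord0 j) * f (lift ord0 j).
  under eq_bigr => j _ do rewrite -mulrA.
  rewrite -mulr_sumr; apply: (mulrI (place_unit Ou nz_u)).
  rewrite mulVKr ?place_unit // mulrBl mul1r {1}f0E addrC addKr //.
have fl0 : forall j, f (lift ord0 j) = 0.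
  apply: IHr => i; have [M [Mm fE]] := fM (lift ord0 i).
  exists (fun j => M ord0 * ((1 - u)^-1 * M0 (lift ord0 j)) + M (lift ord0 j)).
  split=> [j|].
    apply: in_max_D => //; apply: in_max_M; first by case: (Mm ord0).
    by apply: in_max_M => //; apply: place_V.
  rewrite fE big_ord_recl f0E mulr_sumr -big_split.
  by apply: eq_bigr => j _; rewrite mulrDl !mulrA.
move=> i; case: (unliftP ord0 i) => [j|] -> //.
by rewrite f0E big1 // => j _; rewrite fl0 mulr0.
Qed.

End Places.

(** * Finite-dimensional realizations of series together with values *)

Section Realization.
Variables (X : finType) (F : unitAlgType rat) (g : X -> F).

(** Series and values are paired by a relation, not a map: that a series has only one value is what
    realizations serve to prove. *)
Definition relation := series X -> F -> Prop.

Definition subspace (W : relation) :=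
  W (fun=> 0) 0 /\
  forall c t1 t2 t f1 f2, W t1 f1 -> W t2 f2 ->
    (forall w, t w = c * t1 w + t2 w) -> W t (c *: f1 + f2).

Definition in_span (I : finType) (b : I -> series X * F) : relation :=
  fun t f => exists c : I -> rat,
    (forall w, t w = \sum_i c i * (b i).1 w) /\ f = \sum_i c i *: (b i).2.

(* f = t_1 + sum_x x f_x, where t_1 is the constant term of t and each f_x
   is related to the series x^-1 t. *)
Definition unfolds (W : relation) : relation := fun t f =>
  exists h : X -> F, (forall x, W (lquo x t) (h x)) /\
    f = (t [::])%:A + \sum_x g x * h x.

(** The classical linear representation of a rational series, a finite-dimensional space stable
    under left quotients, carried along on the values. *)
Definition coherent (I : finType) (b : I -> series X * F) :=
  forall i, unfolds (in_span b) (b i).1 (b i).2.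

Definition realizes t f := exists (I : finType) (b : I -> series X * F),
  coherent b /\ in_span b t f.

Lemma subspace_ext W t t' f : subspace W -> t =1 t' -> W t f -> W t' f.
Proof.
move=> [W0 WZ] e Wt; rewrite -[f]addr0 -[f]scale1r.
by apply: WZ Wt W0 _ => w; rewrite mul1r addr0 e.
Qed.

Lemma subspace_span_sub W (I : finType) (b : I -> series X * F) :
  subspace W -> (forall i, W (b i).1 (b i).2) ->
  forall t f, in_span b t f -> W t f.
Proof.
move=> sW Wb t f [c [tE ->]]; apply: (subspace_ext sW (fsym tE)).
case: (sW) => W0 WZ; elim: (index_enum I) => [|i r IHr].
  by rewrite big_nil; apply: (subspace_ext sW _ W0) => w; rewrite big_nil.
rewrite big_cons; by apply: WZ (Wb i) IHr _ => w; rewrite big_cons.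
Qed.

Lemma in_span_subspace (I : finType) (b : I -> series X * F) :
  subspace (in_span b).
Proof.
split=> [|c t1 t2 t f1 f2 [c1 [t1E ->]] [c2 [t2E ->]] tE].
  exists (fun=> 0); split=> [w|]; rewrite big1 // => i _; rewrite ?mul0r //.
  by rewrite scale0r.
exists (fun i => c * c1 i + c2 i); split=> [w|].
  rewrite tE t1E t2E mulr_sumr -big_split.
  by apply: eq_bigr => i _; rewrite mulrDl mulrA.
rewrite scaler_sumr -big_split.
by apply: eq_bigr => i _; rewrite scalerDl scalerA.
Qed.

Lemma in_span_gen (I : finType) (b : I -> series X * F) i :
  in_span b (b i).1 (b i).2.
Proof.
exists (fun j => (j == i)%:R); split=> [w|].
  by rewrite (bigD1 i) //= eqxx mul1r big1 ?addr0 // => j /negbTE->; rewrite mul0r.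
by rewrite (bigD1 i) //= eqxx scale1r big1 ?addr0 // => j /negbTE->; rewrite scale0r.
Qed.

Lemma unfolds_subspace W : subspace W -> subspace (unfolds W).
Proof.
move=> [W0 WZ]; split=> [|c t1 t2 t f1 f2 [h1 [Wh1 ->]] [h2 [Wh2 ->]] tE].
  exists (fun=> 0); split=> //.
  by rewrite scale0r add0r big1 // => x _; rewrite mulr0.
exists (fun x => c *: h1 x + h2 x); split=> [x|].
  by apply: WZ (Wh1 x) (Wh2 x) _ => w; rewrite /lquo tE.
rewrite tE scalerDl -scalerA scalerDr -!addrA; congr (_ + _).
rewrite addrCA; congr (_ + _); rewrite scaler_sumr -big_split.
by apply: eq_bigr => x _; rewrite mulrDr scalerAr.
Qed.

Lemma unfolds_mono (W W' : relation) t f :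
  (forall t' f', W t' f' -> W' t' f') -> unfolds W t f -> unfolds W' t f.
Proof. by move=> WW' [h [Wh ->]]; exists h; split=> // x; apply: WW'. Qed.

Lemma coherent_span (I : finType) (b : I -> series X * F) t f :
  coherent b -> in_span b t f -> unfolds (in_span b) t f.
Proof.
by move=> cb; apply: subspace_span_sub => //; apply/unfolds_subspace/in_span_subspace.
Qed.

Lemma mulr_subspace W t f :
  subspace W -> subspace (fun s e => W (series_mul s t) (e * f)).
Proof.
move=> sW; case: (sW) => W0 WZ; split=> [|c s1 s2 s e1 e2 W1 W2 sE].
  by rewrite mul0r; apply: (subspace_ext sW _ W0) => w; rewrite series_mul0l.
rewrite mulrDl -scalerAl; apply: WZ W1 W2 _ => w.
by rewrite -series_mulZl -series_mulDl; apply: eq_series_mul.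
Qed.

(** Both components follow the rule [x^-1 (s t) = (x^-1 s) t + c (x^-1 t)], with [c] the constant
    term of [s]. *)
Lemma unfolds_mul W V s e t f : subspace W ->
    (forall s' e', V s' e' -> W (series_mul s' t) (e' * f)) ->
    unfolds V s e -> unfolds W t f ->
  unfolds W (series_mul s t) (e * f).
Proof.
move=> [_ WZ] VW [h [Vh ->]] [k [Wk fE]].
exists (fun x => s [::] *: k x + h x * f); split=> [x|].
  apply: WZ (Wk x) (VW _ _ (Vh x)) _ => w.
  by rewrite /lquo series_mul_cons addrC.
rewrite series_mul_nil mulrDl mulr_algl {1}fE scalerDr scalerA -addrA.
congr (_ + _); rewrite scaler_sumr mulr_suml -big_split.
by apply: eq_bigr => x _; rewrite mulrDr mulrA scalerAr.
Qed.

Lemma realizes_ext t t' f : t =1 t' -> realizes t f -> realizes t' f.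
Proof.
move=> e [I [b [cb bt]]]; exists I, b; split=> //.
exact: subspace_ext (in_span_subspace b) e bt.
Qed.

Lemma realizes_const c : realizes (series_const c) c%:A.
Proof.
pose b (_ : unit) : series X * F := (series_const 1, 1).
have sb := in_span_subspace b; have [b0 bZ] := sb.
exists unit, b; split=> [i|].
  exists (fun=> 0); split=> [x|]; first exact: subspace_ext sb _ b0.
  by rewrite big1 ?addr0 /= ?scale1r // => x _; rewrite mulr0.
rewrite -[c%:A]addr0; apply: bZ (in_span_gen b tt) b0 _ => w /=.
by rewrite addr0 /series_const mulrnAr mulr1.
Qed.

Lemma realizes_var x : realizes (series_var x) (g x).
Proof.
pose b (i : bool) := if i then (series_var x, g x) else (series_const 1, 1).
have [b0 bZ] := in_span_subspace b.
have b1 := in_span_gen b false.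
exists bool, b; split; last exact: (in_span_gen b true).
case=> /=.
  exists (fun y => (x == y)%:R); split=> [y|].
    have := bZ (x == y)%:R _ _ (lquo y (series_var x)) _ _ b1 b0.
    rewrite scaler_nat addr0 => H; rewrite -(mulr_natl 1 (x == y)) mulr1 in H.
    apply: H => w.
    rewrite /= addr0 /lquo /series_var /series_const eqseq_cons eq_sym.
    by case: eqP; rewrite ?mul0r ?mul1r // eqE.
  rewrite scale0r add0r (bigD1 x) //= eqxx mulr1 big1 ?addr0 // => y.
  by rewrite eq_sym => /negbTE->; rewrite mulr0.
exists (fun=> 0); split=> [y|].
  by apply: subspace_ext b0 => //; apply: in_span_subspace.
by rewrite scale1r big1 ?addr0 // => y _; rewrite mulr0.
Qed.

Lemma realizes_add t1 f1 t2 f2 :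
  realizes t1 f1 -> realizes t2 f2 -> realizes (series_add t1 t2) (f1 + f2).
Proof.
move=> [I1 [b1 [cb1 bt1]]] [I2 [b2 [cb2 bt2]]].
pose b (i : I1 + I2) := match i with inl i => b1 i | inr i => b2 i end.
have [b0 bZ] := in_span_subspace b.
have sub1 t f : in_span b1 t f -> in_span b t f.
  by apply: subspace_span_sub => // i; apply: (in_span_gen b (inl i)).
have sub2 t f : in_span b2 t f -> in_span b t f.
  by apply: subspace_span_sub => // i; apply: (in_span_gen b (inr i)).
exists (I1 + I2)%type, b; split.
  by case=> i; [apply: unfolds_mono sub1 (cb1 i)|apply: unfolds_mono sub2 (cb2 i)].
rewrite -[f1]scale1r; apply: bZ (sub1 _ _ bt1) (sub2 _ _ bt2) _ => w.
by rewrite mul1r.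
Qed.

(** Left quotients of a product only involve left quotients of [t1] multiplied by [t2], and left
    quotients of [t2]; the two kinds of generators below span them. *)
Lemma realizes_mul t1 f1 t2 f2 :
  realizes t1 f1 -> realizes t2 f2 -> realizes (series_mul t1 t2) (f1 * f2).
Proof.
move=> [I1 [b1 [cb1 bt1]]] [I2 [b2 [cb2 bt2]]].
pose b (i : I1 + I2) :=
  match i with inl i => (series_mul (b1 i).1 t2, (b1 i).2 * f2) | inr i => b2 i end.
have sb := in_span_subspace b.
have sub1 t f : in_span b1 t f -> in_span b (series_mul t t2) (f * f2).
  apply: (subspace_span_sub (mulr_subspace t2 f2 sb)) => i.
  exact: (in_span_gen b (inl i)).
have sub2 t f : in_span b2 t f -> in_span b t f.
  by apply: subspace_span_sub => // i; apply: (in_span_gen b (inr i)).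
exists (I1 + I2)%type, b; split; last exact: sub1.
case=> i; last exact: unfolds_mono sub2 (cb2 i).
apply: unfolds_mul sb sub1 (cb1 i) _.
exact: unfolds_mono sub2 (coherent_span cb2 bt2).
Qed.

(** The left quotient of the star by [x] is [x^-1 t] times the star. On values, [e = 1 + f * e] says
    the same once [f] is unfolded, its constant term being 0. *)
Lemma realizes_star t f e : t [::] = 0 -> e = 1 + f * e ->
  realizes t f -> realizes (series_star t) e.
Proof.
move=> t0 eE [I [b1 [cb1 bt1]]].
pose b (i : option I) :=
  if i is Some i then (series_mul (b1 i).1 (series_star t), (b1 i).2 * e)
  else (series_star t, e).
have sb := in_span_subspace b.
have sub1 u h : in_span b1 u h -> in_span b (series_mul u (series_star t)) (h * e).
  apply: (subspace_span_sub (mulr_subspace (series_star t) e sb)) => i.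
  exact: (in_span_gen b (Some i)).
have ue : unfolds (in_span b) (series_star t) e.
  have [h [bh fE]] := coherent_span cb1 bt1.
  exists (fun x => h x * e); split=> [x|].
    apply: subspace_ext (sub1 _ _ (bh x)) => // w.
    by rewrite /lquo series_star_cons.
  rewrite series_star_nil scale1r {1}eE fE t0 scale0r add0r mulr_suml.
  by congr (_ + _); apply: eq_bigr => x _; rewrite mulrA.
exists (option I), b; split; last exact: (in_span_gen b None).
by case=> [i|] //; apply: unfolds_mul sb sub1 (cb1 i) ue.
Qed.

End Realization.

(** Subspaces contained in [P] are enlarged one dimension at a time until they exhaust it; the
    dimension of [V] bounds the process. *)
Lemma vspace_of_predicate (K : fieldType) (V : vectType K) (P : V -> Prop) :
    P 0 -> (forall c u v, P u -> P v -> P (c *: u + v)) ->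
  exists U : {vspace V}, forall v, v \in U <-> P v.
Proof.
move=> P0 PZ.
have grow k : (exists U : {vspace V}, forall v, v \in U <-> P v) \/
    exists U : {vspace V}, (forall v, v \in U -> P v) /\ (k <= \dim U)%N.
  elim: k => [|k [IHk|[U [UP le_k]]]]; first 2 [by left].
    by right; exists 0%VS; split=> // v; rewrite memv0 => /eqP->.
  have [PU|] := pselect (forall v, P v -> v \in U).
    by left; exists U => v; split; [apply: UP | apply: PU].
  move/existsNP => [v /not_implyP [Pv /negP vU]].
  right; exists (<[v]> + U)%VS; split=> [w|].
    move/memv_addP => [a /vlineP [c ->] [u /UP Pu ->]]; exact: PZ.
  suff: (\dim U < \dim (<[v]> + U))%N by apply: leq_ltn_trans.
  rewrite (ltn_leqif (dimv_leqif_sup (addvSr _ _))).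
  by apply: contra vU => /subvP; apply; rewrite (subvP (addvSl _ _)) ?memv_line.
have [//|[U [_]]] := grow (\dim {:V}).+1.
by rewrite ltnNge dimvS ?subvf.
Qed.

(** * Uniqueness of the value of a series *)

Section RealizationUnique.
Variables (X : finType) (F D : unitAlgType rat) (g : X -> F).
Variables (O : {pred F}) (nu : F -> D).
Hypotheses (skewF : skew_field F) (plO : place O nu).
Hypothesis g_max : forall x, in_max O nu (g x).

Lemma realizes_zero f : realizes g (fun=> 0) f -> f = 0.
Proof.
move=> [I [b [cb b0f]]].
pose V : vectType rat := {ffun I -> rat^o}.
(* [P] collects the coefficient vectors whose combination of the generating series is 0, and [phi]
   sends them to the corresponding values, which have to vanish. *)
pose P (c : V) := forall w, \sum_i c i * (b i).1 w = 0.
pose phi (c : V) := \sum_i c i *: (b i).2.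
have phi_span c : P c -> in_span b (fun=> 0) (phi c).
  by move=> Pc; exists c; split=> [w|//]; rewrite Pc.
have span_phi h : in_span b (fun=> 0) h -> exists2 c, P c & h = phi c.
  move=> [c [cE ->]]; exists [ffun i => c i : rat^o] => [w|].
    by rewrite [RHS](cE w); apply: eq_bigr => i _; rewrite ffunE.
  by apply: eq_bigr => i _; rewrite ffunE.
have phiZ c u v : phi (c *: u + v) = c *: phi u + phi v.
  rewrite /phi scaler_sumr -big_split; apply: eq_bigr => i _.
  by rewrite !ffunE scalerDl scalerA.
have [U UP] : exists U : {vspace V}, forall v, v \in U <-> P v.
  apply: vspace_of_predicate => [w|c u v Pu Pv w].
    by rewrite big1 // => i _; rewrite ffunE mul0r.
  under eq_bigr => i _ do rewrite !ffunE mulrDl -mulrA.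
  by rewrite big_split /= -mulr_sumr Pu Pv mulr0 addr0.
pose e i := (vbasis U)`_i.
have phi_basis c : P c ->
    phi c = \sum_(i < \dim U) coord (vbasis U) i c *: phi (e i).
  move=> /UP cU; rewrite {1}(coord_vbasis cU).
  have phi0 : phi 0 = 0.
    by have := phiZ (-1) 0 0; rewrite scaler0 addr0 scaleN1r addNr.
  apply: (big_rec2 (fun u v => phi u = v)) => // i v u _ <-.
  by rewrite phiZ.
have phi_e0 : forall i : 'I_(\dim U), phi (e i) = 0.
  apply: (nakayama skewF plO) => i.
  have Pe : P (e i) by apply/UP/vbasis_mem/mem_nth; rewrite size_tuple.
  (* The left quotients of the series 0 are 0, so the [h x] are again values of vectors in [P]; the
     constant term contributes nothing, and every remaining coefficient has a factor [g x] in the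
     maximal ideal. *)
  have [h [hspan ->]] := coherent_span cb (phi_span _ Pe).
  have /fin_all_exists[d hE] x : exists d : 'I_(\dim U) -> rat,
      h x = \sum_j d j *: phi (e j).
    have [c Pc ->] := span_phi _ (hspan x).
    by rewrite phi_basis //; exists (fun j => coord (vbasis U) j c).
  exists (fun j => \sum_x g x * (d x j)%:A); split=> [j|].
    elim/big_ind: _ => [||x _]; [exact: in_max_0 plO | |].
      exact: in_max_D plO.
    by apply: (in_max_Mr plO) => //; apply: (place_Z plO); apply: (place_1 plO).
  rewrite scale0r add0r.
  under [RHS]eq_bigr => j _ do rewrite mulr_suml.
  rewrite exchange_big; apply: eq_bigr => x _.
  rewrite hE mulr_sumr; apply: eq_bigr => j _.
  by rewrite -mulrA mulr_algl.
have [c Pc ->] := span_phi _ b0f.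
by rewrite phi_basis // big1 // => i _; rewrite phi_e0 scaler0.
Qed.

End RealizationUnique.

Section StarExpressionValue.
Variables (X : finType) (F D : unitAlgType rat).
Variable iota : {lrmorphism freealg X -> F}.
Variables (O : {pred F}) (nu : F -> D).
Hypotheses (skewF : skew_field F) (plO : place O nu).
Hypothesis var_max : forall x, in_max O nu (iota (var x)).

Lemma computes_realizes (e : star_expr X) f :
    well_formed e -> computes iota (star_rexpr e) f ->
  realizes (fun x => iota (var x)) (star_series e) f.
Proof.
elim: e f => [c|x|e1 IH1 e2 IH2|e1 IH1 e2 IH2|e1 IH1] f /=.
- move=> _ ce; inversion ce; subst.
  by rewrite linearZ rmorph1; apply: realizes_const.
- by move=> _ ce; inversion ce; subst; apply: realizes_var.
- move=> /andP[w1 w2] ce; inversion ce; subst.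
  by apply: realizes_add; [apply: IH1 | apply: IH2].
- move=> /andP[w1 w2] ce; inversion ce; subst.
  by apply: realizes_mul; [apply: IH1 | apply: IH2].
move=> /andP[w1 /eqP e0] ce; inversion ce as [| | |? y cy nz]; subst.
inversion cy as [|? ? y1 y2 c1 c2| |]; subst.
inversion c1; subst; inversion c2 as [| |? ? z1 z2 d1 d2|]; subst.
inversion d1; subst.
apply: realizes_star (IH1 _ w1 d2) => //.
move: nz; rewrite rmorphN1 rmorph1 mulN1r => nz.
by apply/eqP; rewrite -subr_eq -{1}[_^-1]mul1r -mulrBl divrr // skewF.
Qed.

Lemma series_image_unique (s : series X) f1 f2 :
  series_image iota s f1 -> series_image iota s f2 -> f1 = f2.
Proof.
move=> [e1 [w1 s1 c1]] [e2 [w2 s2 c2]]; apply/eqP; rewrite -subr_eq0; apply/eqP.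
apply: (realizes_zero skewF plO var_max).
pose e := SAdd e1 (SMul (SConst (-1)) e2).
have ce : computes iota (star_rexpr e) (f1 - f2).
  rewrite -mulN1r -(rmorphN1 iota) -scaleN1r.
  by apply: ComputesAdd => //; apply: ComputesMul => //; apply: ComputesPoly.
have we : well_formed e by rewrite /= w1.
apply: realizes_ext (computes_realizes we ce) => w /=.
rewrite /series_add series_mul1l s1 s2 mulN1r subrr //.
Qed.

Lemma embed_seriesE (s : series X) f : series_image iota s f ->
  embed_series iota s = f.
Proof.
by move=> sf; apply: xget_unique => // f' /series_image_unique; apply.
Qed.

End StarExpressionValue.

(** * Kleene elimination over a stochastic matrix *)

Section Elimination.
Variables (I : finType) (R : unitRingType) (A : I -> I -> R).
Implicit Types (L : seq I) (p q r : I).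

(* Kleene's algorithm: [path_sum L p q] is the sum of the nonempty paths from
   p to q all of whose intermediate vertices lie in L. *)
Fixpoint path_sum L p q : R :=
  if L is r :: L' then
    path_sum L' p q +
      path_sum L' p r * ((1 - path_sum L' r r)^-1 * path_sum L' r q)
  else A p q.

(* The formal derivative of [path_sum L p q] when each letter is its own
   derivative. *)
Fixpoint path_sum_deriv L p q : R :=
  if L is r :: L' then
    let T := (1 - path_sum L' r r)^-1 in
    path_sum_deriv L' p q +
      (path_sum_deriv L' p r * (T * path_sum L' r q) +
       path_sum L' p r * (T * (path_sum_deriv L' r r * T) * path_sum L' r q +
                          T * path_sum_deriv L' r q))
  else A p q.

Fixpoint pivots_unit L : Prop :=
  if L is r :: L' then
    pivots_unit L' /\ 1 - path_sum L' r r \is a GRing.unit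
  else True.

Lemma path_sum_last r L p : 1 - path_sum L r r \is a GRing.unit ->
  path_sum (r :: L) p r = path_sum L p r * (1 - path_sum L r r)^-1.
Proof.
move=> u /=; set T := (_)^-1; set k := path_sum L r r in u T *.
have Tk : T * k = T - 1.
  by rewrite -[k in LHS](subKr 1) mulrBr mulr1 mulVr.
by rewrite Tk mulrBr mulr1 addrC subrK.
Qed.

(** This mirrors splitting a path at its last edge, but in [R] it has to be derived algebraically
    from the recursion on [L]. *)
Lemma path_sum_rec_right L p q : pivots_unit L ->
  path_sum L p q = A p q + \sum_(k <- L) path_sum L p k * A k q.
Proof.
elim: L p q => [|r L IHL] p q; first by rewrite big_nil addr0.
case=> /IHL {}IHL u; rewrite big_cons path_sum_last //= {1}(IHL p q) (IHL r q).
under [X in _ = _ + (_ + X)]eq_bigr => k _ do rewrite mulrDl -!mulrA.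
rewrite big_split /= -!mulr_sumr !mulrDr -!mulrA -!addrA; congr (_ + _).
by rewrite addrCA.
Qed.

(** Passing from [L] to [r :: L] drops the term [K_L(p, r)]; the new Kleene terms sum to [K_L(p, r)
    (1 - K_L(r, r))^-1 (1 - K_L(r, r))], which restores it. *)
Lemma path_sum_escape L p : uniq L -> pivots_unit L ->
    (forall i, \sum_j A i j = 1) ->
  \sum_(q | q \notin L) path_sum L p q = 1.
Proof.
move=> + + A1; elim: L p => [|r L IHL] p; first by move=> _ _; apply: A1.
case/andP=> rL uL [pL u] /=.
have {}IHL i : \sum_(q | q \notin r :: L) path_sum L i q = 1 - path_sum L i r.
  rewrite -(IHL i uL pL) [in RHS](bigD1 r) //= [RHS]addrC addKr.
  by apply: eq_bigl => q; rewrite inE negb_or andbC.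
rewrite big_split /= -!mulr_sumr !IHL mulVr // mulr1 subrK //.
Qed.

(** The equation for [z r] is solved for [z r]; substituting the result in the other equations
    reproduces Kleene's recursion. *)
Lemma path_sum_left_fixed L (z : I -> R) q : pivots_unit L ->
    (forall j, z j = \sum_i z i * A i j) ->
  uniq L -> z q = \sum_(p | p \notin L) z p * path_sum L p q.
Proof.
move=> + zA; elim: L q => [|r L IHL] q; first by [].
case=> pL u /andP[rL uL].
have {}IHL j : z j = z r * path_sum L r j +
    \sum_(p | p \notin r :: L) z p * path_sum L p j.
  rewrite {1}(IHL j pL uL) (bigD1 r) //=; congr (_ + _).
  by apply: eq_bigl => p; rewrite inE negb_or andbC.
have zr : z r = (\sum_(p | p \notin r :: L) z p * path_sum L p r)
    * (1 - path_sum L r r)^-1.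
  by apply: (canRL (mulrK u)); rewrite mulrBr mulr1 {1}(IHL r) addrC addKr.
rewrite (IHL q) /= addrC.
under [RHS]eq_bigr => p _ do rewrite mulrDr !mulrA.
by rewrite big_split /= {1}zr -!mulr_suml.
Qed.

(** For a Markov chain, the derivative weights each path by its length, so the left side is the
    expected exit time from [L]; the right side counts the first step and the visits in [L]. *)
Lemma path_sum_deriv_escape L p : uniq L -> pivots_unit L ->
    (forall i, \sum_j A i j = 1) ->
  \sum_(q | q \notin L) path_sum_deriv L p q = 1 + \sum_(k <- L) path_sum L p k.
Proof.
move=> + + A1; elim: L p => [|r L IHL] p.
  by move=> _ _; rewrite big_nil addr0; apply: A1.
case/andP=> rL uL [pL u]; rewrite big_cons path_sum_last //=.
set T := (_)^-1.
have rest (f : I -> R) : \sum_(q | q \notin r :: L) f q =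
    \sum_(q | q \notin L) f q - f r.
  rewrite [in RHS](bigD1 r) //= [RHS]addrC addKr.
  by apply: eq_bigl => q; rewrite inE negb_or andbC.
have T1 : T * (1 - path_sum L r r) = 1 by rewrite mulVr.
rewrite !big_split /= -!mulr_sumr big_split /= -!mulr_sumr !rest.
rewrite !IHL // !path_sum_escape // -!mulrA T1 !mulr1.
rewrite addrA subrK -mulrDr [path_sum_deriv L r r + _]addrC subrK.
by rewrite !mulrDr mulr1 -!addrA; congr (_ + _); rewrite addrCA.
Qed.

Lemma derivation_1 (d : R -> R) : derivation d -> d 1 = 0.
Proof.
case=> _ dM; have := dM 1 1; rewrite !mulr1 mul1r => /eqP.
by rewrite -subr_eq subrr => /eqP.
Qed.

Lemma derivation_path_sum (d : R -> R) L p q : derivation d ->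
    (forall i j, d (A i j) = A i j) -> pivots_unit L ->
  d (path_sum L p q) = path_sum_deriv L p q.
Proof.
move=> dd dA; have [dD dM] := dd; have d1 := derivation_1 dd.
elim: L p q => [|r L IHL] p q /=; first by [].
case=> /IHL {}IHL u; set T := (_)^-1.
(* Obtained by differentiating [(1 - path_sum L r r) * T = 1]. *)
have dT : d T = T * (path_sum_deriv L r r * T).
  apply: (mulrI u); rewrite mulVKr //.
  have := dM (1 - path_sum L r r) T; rewrite mulrV // d1 => /eqP.
  rewrite eq_sym addrC addr_eq0 => /eqP ->; rewrite -mulNr; congr (_ * _).
  have := dD (1 - path_sum L r r) (path_sum L r r); rewrite subrK d1 IHL => /eqP.
  by rewrite eq_sym addrC addr_eq0 => /eqP ->.
by rewrite dD !dM dT !IHL.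
Qed.

End Elimination.

(** * Invariant vectors of a stochastic matrix *)

Section StochasticElimination.
Variables (I : finType) (R : unitRingType) (A : I -> I -> R).

Definition others (i : I) := [seq j <- index_enum I | j != i].

Lemma mem_others i j : (j \in others i) = (j != i).
Proof. by rewrite mem_filter mem_index_enum andbT. Qed.

Lemma others_uniq i : uniq (others i).
Proof. exact/filter_uniq/index_enum_uniq. Qed.

Lemma size_others i : (size (others i) < #|I|)%N.
Proof.
rewrite -(card_uniqP (others_uniq i)); apply/proper_card/properP.
by split; [exact: subset_predT | exists i; rewrite // mem_others eqxx].
Qed.

(** In the free field, this and the next definition give the values of [C_i] and [P_i]. *)
Definition return_sum i : R := path_sum A (others i) i i.

Definition escape_sum i : R :=
  1 + \sum_(k <- others i) path_sum A (others i) i k.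

Hypothesis A1 : forall i, \sum_j A i j = 1.
Hypothesis pivots : forall i, pivots_unit A (others i).

(** For a Markov chain, the expected number of visits to [j] up to the first return to [i], the
    start not counted. *)
Let visits i j := path_sum A (others i) i j.

Let notin_others i j : (j \notin others i) = (j == i).
Proof. by rewrite mem_others negbK. Qed.

Lemma return_sumE i : return_sum i = 1.
Proof.
rewrite -(path_sum_escape i (others_uniq i) (pivots i) A1).
by rewrite (eq_bigl _ _ (notin_others i)) big_pred1_eq.
Qed.

Lemma return_deriv i : path_sum_deriv A (others i) i i = escape_sum i.
Proof.
rewrite /escape_sum -(path_sum_deriv_escape i (others_uniq i) (pivots i) A1).
by rewrite (eq_bigl _ _ (notin_others i)) big_pred1_eq.
Qed.

(** The empty path in [P_i] contributes 1, which is also [visits i i] because [C_i] has value 1. *)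
Lemma escape_sumE i : escape_sum i = \sum_j visits i j.
Proof.
by rewrite /escape_sum big_filter -(return_sumE i) [RHS](bigD1 i).
Qed.

(** The last-edge recursion: its isolated term [A i j] is the summand [k = i], as
    [visits i i = 1]. *)
Lemma visits_fixed i j : visits i j = \sum_k visits i k * A k j.
Proof.
rewrite (bigD1 i) //= [visits i i]return_sumE mul1r.
by rewrite /visits {1}(path_sum_rec_right _ _ (pivots i)) big_filter.
Qed.

Lemma visits_trans i j k : visits i k = visits i j * visits j k.
Proof.
rewrite (path_sum_left_fixed k (pivots j) (visits_fixed i) (others_uniq j)).
by rewrite (eq_bigl _ _ (notin_others j)) big_pred1_eq.
Qed.

Hypothesis unit_escape : forall i, escape_sum i \is a GRing.unit.

(** Summing [visits_trans] over [k] gives [escape_sum i = visits i j * escape_sum j]. *)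
Lemma escape_sumV i j : (escape_sum j)^-1 = (escape_sum i)^-1 * visits i j.
Proof.
apply: (canRL (mulKr (unit_escape i))); rewrite (escape_sumE i).
under eq_bigr => k _ do rewrite (visits_trans i j).
by rewrite -mulr_sumr -escape_sumE mulrK.
Qed.

Lemma escape_sumV_fixed j :
  \sum_i (escape_sum i)^-1 * A i j = (escape_sum j)^-1.
Proof.
under eq_bigr => i _ do rewrite (escape_sumV j) -mulrA.
by rewrite -mulr_sumr -visits_fixed -escape_sumV.
Qed.

Lemma sum_escape_sumV (i : I) : \sum_j (escape_sum j)^-1 = 1.
Proof.
under eq_bigr => j _ do rewrite (escape_sumV i).
by rewrite -mulr_sumr -escape_sumE mulVr.
Qed.

End StochasticElimination.

(** * Nonvanishing of pivots by specialization to a constant *)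

Section Evaluation.
Variables (I : finType) (F : unitAlgType rat) (A : I -> I -> F).
Variables (O : {pred F}) (nu : F -> (rat^o : unitAlgType rat)) (c : rat).
Hypotheses (skewF : skew_field F) (plO : place O nu).
Hypothesis A_c : forall i j, A i j \in O /\ nu (A i j) = c.

(** Serves with [c = 0] in the free field and [c = 1/n] in the stochastic one. A Kleene step turns
    the common value [x] into [x + x^2 / (1 - x) = x / (1 - x)]. *)
Lemma place_path_sum L :
    (forall k, (k <= size L)%N -> 1 - k%:R * c != 0) ->
  pivots_unit A L /\ forall p q, path_sum A L p q \in O /\
    nu (path_sum A L p q) = c / (1 - (size L)%:R * c).
Proof.
have skewQ : skew_field (rat^o : unitAlgType rat) by move=> x; rewrite unitfE.
elim: L => [|r L IHL] /= cL.
  by split=> // p q; rewrite mul0r subr0 divr1.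
have [k le_kL|pL sumL] := IHL; first by apply: cL; rewrite (leq_trans le_kL).
set x := c / _ in sumL.
have dL := cL _ (leqnSn _); have dSL := cL _ (leqnn _).
have [Or nur] := sumL r r.
have O1 : 1 - path_sum A L r r \in O.
  by rewrite (place_D plO) ?(place_N plO) ?(place_1 plO).
have nu1r : nu (1 - path_sum A L r r) = 1 - x.
  rewrite (nuD plO) ?(place_N plO) ?(place_1 plO) //.
  by rewrite (nuN plO) // (nu1 plO) nur.
have x1 : 1 - x != 0.
  have -> : 1 - x = (1 - (size L).+1%:R * c) / (1 - (size L)%:R * c).
    by rewrite /x -natr1; field.
  by rewrite mulf_neq0 ?invr_neq0.
have nz : nu (1 - path_sum A L r r) != 0 by rewrite nu1r.
split=> [|p q]; first by split=> //; apply: (place_unit skewF plO O1 nz).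
have OV := place_V plO O1 nz.
have [[Opq nupq] [Opr nupr] [Orq nurq]] := And3 (sumL p q) (sumL p r) (sumL r q).
have OVq := place_M plO OV Orq; have Op := place_M plO Opr OVq.
split; first exact: (place_D plO).
rewrite (nuD plO) // !(nuM plO) // (nuV skewF skewQ plO) // nu1r nupq nupr nurq.
by rewrite /x -natr1; field; rewrite natr1 dSL.
Qed.

End Evaluation.

(** * Path series *)

Section PathExpressions.
Variable n : nat.
Implicit Types (L : seq 'I_n) (p q r : 'I_n) (w : seq (letter n)).

Fixpoint path_expr L p q : star_expr (letter n) :=
  if L is r :: L' then
    SAdd (path_expr L' p q)
      (SMul (path_expr L' p r) (SMul (SStar (path_expr L' r r)) (path_expr L' r q)))
  else SVar ((p, q) : letter n).

(** Shaped as the argument of the inverse that [star_rexpr] produces from a star. *)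
Definition path_expr_1B L r : rexpr (letter n) :=
  RAdd (RPoly 1) (RMul (RPoly (- 1)) (star_rexpr (path_expr L r r))).

Fixpoint path_deriv_expr L p q : rexpr (letter n) :=
  if L is r :: L' then
    let K p q := star_rexpr (path_expr L' p q) in
    let dK := path_deriv_expr L' in
    let T := RInv (path_expr_1B L' r) in
    RAdd (dK p q)
      (RAdd (RMul (dK p r) (RMul T (K r q)))
        (RMul (K p r) (RAdd (RMul (RMul T (RMul (dK r r) T)) (K r q))
                            (RMul T (dK r q)))))
  else RPoly (a p q).

Definition path_series L p q : series (letter n) := fun w =>
  let s := unzip2 w in
  [&& w == path_word p s, s != [::], last p s == q &
      all (mem L) (behead (belast p s))]%:R.

Lemma path_series_cons L p q r k w :
  path_series L p q ((r, k) :: w) =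
  (r == p)%:R * ((k == q)%:R *+ (w == [::]) + (k \in L)%:R * path_series L k q w).
Proof.
rewrite /path_series /= eqseq_cons xpair_eqE eqxx andbT eq_sym.
case: (p == r); last by rewrite mul0r.
rewrite mul1r; case: w => [|[r' k'] w] /=; first by rewrite mulr0 addr0 andbT.
by rewrite add0r -natrM mulnb; congr (_ %:R); do !case: (_ \in _) => //=;
  rewrite ?andbF.
Qed.

Lemma path_expr_nil L p q : star_series (path_expr L p q) [::] = 0.
Proof.
elim: L p q => [|r L IHL] p q //=.
by rewrite /series_add series_mul_nil !IHL mul0r addr0.
Qed.

Lemma path_expr_wf L p q : well_formed (path_expr L p q).
Proof.
by elim: L p q => [|r L IHL] p q //=; rewrite !IHL path_expr_nil eqxx.
Qed.

(** The same first-letter recursion as [path_series_cons]. Since it determines the series, no path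
    has to be factored at its visits to the eliminated vertex. *)
Lemma path_expr_cons L p q r k w : uniq L ->
  star_series (path_expr L p q) ((r, k) :: w) = (r == p)%:R *
    ((k == q)%:R *+ (w == [::]) + (k \in L)%:R * star_series (path_expr L k q) w).
Proof.
move=> uL; elim: L uL p q r k w => [|j L IHL] /= => [_|/andP[jL uL]] p q r k w.
  rewrite mul0r addr0 /series_var eqseq_cons xpair_eqE.
  by rewrite -!mulnb !natrM -mulrA mulr_natr.
pose t p q := star_series (path_expr L p q).
pose u := series_mul (series_star (t j j)) (t j q).
have tj w' : u w' = t j q w' + series_mul (t j j) u w'.
  rewrite [LHS](eq_series_mul (fun v => series_starE v (path_expr_nil L j j)) (frefl _)).
  by rewrite series_mulDl series_mul1l mul1r series_mulA.
have lquo_t : lquo (r, k) (t p j) =1 fun v => (r == p)%:R *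
    series_add (series_const (k == j)%:R) (fun v' => (k \in L)%:R * t k j v') v.
  by move=> v; rewrite /lquo /t IHL.
rewrite /series_add IHL // series_mul_cons path_expr_nil mul0r addr0.
rewrite -/(t j j) -/(t j q) -/u -/(t k j) -/(t p j) -/(t k q).
rewrite (eq_series_mul lquo_t (frefl _)) series_mulZl series_mulDl.
rewrite series_mul1l series_mulZl -mulrDr; congr (_ * _).
(* For [k = j], the Kleene term contributes [u], which [tj] expands into the two expected terms; [j]
   not being in [L] prevents double counting. *)
rewrite inE; have [->|_] := eqVneq k j; last by rewrite mul0r add0r -addrA -mulrDr.
by rewrite (negbTE jL) !mul0r !addr0 !mul1r -tj.
Qed.

Lemma path_exprE L p q : uniq L -> star_series (path_expr L p q) =1 path_series L p q.
Proof.
move=> uL w; elim: w p => [|[r k] w IHw] p; first by rewrite path_expr_nil.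
by rewrite path_expr_cons // path_series_cons IHw.
Qed.

Lemma C_seriesE (i : 'I_n) : path_series (others i) i i =1 C_series i.
Proof.
move=> w; rewrite /path_series /C_series; congr ([&& _, _, _ & _]%:R).
by elim: (behead _) => //= j s ->; rewrite inE negb_or mem_others eq_sym.
Qed.

Definition escape_expr i : star_expr (letter n) :=
  foldr (fun k => SAdd (path_expr (others i) i k)) (SConst 1) (others i).

Lemma escape_expr_wf i : well_formed (escape_expr i).
Proof.
by rewrite /escape_expr; elim: {2}(others i) => //= k L; rewrite path_expr_wf.
Qed.

(** Nonempty paths are sorted by their end vertex [k], different from [i], with intermediate
    vertices in [others i]; [SConst 1] accounts for the empty path. *)
Lemma P_seriesE i : star_series (escape_expr i) =1 P_series i.
Proof.
move=> w; have -> : star_series (escape_expr i) w =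
    \sum_(k <- others i) path_series (others i) i k w + (w == [::])%:R.
  rewrite /escape_expr; elim: {2 3}(others i) => [|k L IHL] /=.
    by rewrite big_nil add0r.
  by rewrite /series_add IHL big_cons addrA path_exprE // others_uniq.
rewrite /P_series big_filter.
have [->|w0] := eqVneq w [::]; first by rewrite big1 ?add0r.
rewrite addr0 /path_series; case: w w0 => [//|[r k] w] _.
have -> : (i \notin unzip2 ((r, k) :: w)) =
    (last i (unzip2 ((r, k) :: w)) != i) &&
    all (mem (others i)) (behead (belast i (unzip2 ((r, k) :: w)))).
  rewrite /= lastI mem_rcons inE negb_or eq_sym; congr (_ && _).
  by elim: (belast _ _) => //= j s <-; rewrite inE negb_or mem_others eq_sym.
case: (_ == path_word _ _); last by rewrite big1.
case: (all _ _); last by rewrite big1 ?andbF // => j _; rewrite andbF.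
have [li|li] := eqVneq _ i.
  by rewrite big1 // => j ji; rewrite li [i == j]eq_sym (negbTE ji).
rewrite (bigD1 (last i (unzip2 ((r, k) :: w)))) //= eqxx big1 ?addr0 // => j /andP[_].
by rewrite [_ == j]eq_sym => /negbTE->.
Qed.

End PathExpressions.

(** * Values in the stochastic free field *)

Section ExpressionValues.
Variables (n : nat) (R : unitAlgType rat).
Variable mu : {lrmorphism freealg (letter n) -> R}.
Let A i j := mu (a i j).

Lemma computes_1B L r :
    computes mu (star_rexpr (path_expr L r r)) (path_sum A L r r) ->
    1 - path_sum A L r r \is a GRing.unit ->
  computes mu (RInv (path_expr_1B L r)) (1 - path_sum A L r r)^-1.
Proof.
move=> cK u; apply: ComputesInv; last by apply: contraTneq u => ->; rewrite unitr0.
rewrite -mulN1r -(rmorph1 mu) -rmorphN.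
by apply: ComputesAdd (ComputesMul _ cK); apply: ComputesPoly.
Qed.

Lemma computes_path_sum L p q : pivots_unit A L ->
  computes mu (star_rexpr (path_expr L p q)) (path_sum A L p q).
Proof.
elim: L p q => [|r L IHL] p q /=; first by move=> _; apply: ComputesPoly.
case=> /IHL {}IHL u; apply: ComputesAdd => //; apply: ComputesMul => //.
by apply: ComputesMul => //; apply: computes_1B.
Qed.

Lemma computes_path_sum_deriv L p q : pivots_unit A L ->
  computes mu (path_deriv_expr L p q) (path_sum_deriv A L p q).
Proof.
elim: L p q => [|r L IHL] p q /=; first by move=> _; apply: ComputesPoly.
case=> pL u; have cK i j := computes_path_sum i j pL.
have cT := computes_1B (cK r r) u.
by repeat first [apply: ComputesAdd | exact: cT | exact: cK | exact: IHL
                | apply: ComputesMul].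
Qed.

Lemma computes_escape_sum i : pivots_unit A (others i) ->
  computes mu (star_rexpr (escape_expr i)) (escape_sum A i).
Proof.
move=> pL; rewrite /escape_sum /escape_expr addrC.
elim: {2 3}(others i) => [|k L IHL] /=.
  have -> : \sum_(k <- [::]) path_sum A (others i) i k + 1 = mu 1%:A.
    by rewrite big_nil add0r scale1r rmorph1.
  exact: ComputesPoly.
by rewrite big_cons -addrA; apply: ComputesAdd => //; apply: computes_path_sum.
Qed.

End ExpressionValues.

Section Values.
Variables (X : choiceType) (F S : unitAlgType rat).
Variables (iota : {lrmorphism freealg X -> F}) (mu : {lrmorphism freealg X -> S}).
Hypotheses (freeF : is_free_field iota) (skewS : skew_field S).

(** The value in [S] is [nu f], which depends on the element [f] and not on the expression [e]. *)
Lemma computes_extends O nu e f v : extends_to iota mu O nu ->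
  computes iota e f -> computes mu e v -> f \in O /\ nu f = v.
Proof.
move=> ext; have plO := extends_to_place ext; case: ext => _ Onu _ _ _.
have [skewF _ _ _] := freeF.
elim: e f v => [p|e1 IH1 e2 IH2|e1 IH1 e2 IH2|e IH] f v ce cv;
  inversion ce; inversion cv; subst.
- exact: Onu.
- have [O1 <-] := IH1 _ _ ltac:(eassumption) ltac:(eassumption).
  have [O2 <-] := IH2 _ _ ltac:(eassumption) ltac:(eassumption).
  by split; [exact: (place_D plO) | rewrite (nuD plO)].
- have [O1 <-] := IH1 _ _ ltac:(eassumption) ltac:(eassumption).
  have [O2 <-] := IH2 _ _ ltac:(eassumption) ltac:(eassumption).
  by split; [exact: (place_M plO) | rewrite (nuM plO)].
have [O1 e1] := IH _ _ ltac:(eassumption) ltac:(eassumption); subst.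
by split; [exact: (place_V plO) | rewrite (nuV skewF skewS plO)].
Qed.

Lemma evaluates_to_unique f v1 v2 :
  evaluates_to iota mu f v1 -> evaluates_to iota mu f v2 -> v1 = v2.
Proof.
move=> [e1 [c1 d1]] [e2 [c2 d2]].
have [_ _ _ /(_ S mu skewS)[O [nu ext]]] := freeF.
have [_ <-] := computes_extends ext c1 d1.
by have [_ ->] := computes_extends ext c2 d2.
Qed.

Lemma valueE f v : evaluates_to iota mu f v -> value iota mu f = v.
Proof.
by move=> fv; apply: xget_unique => // v' /evaluates_to_unique; apply.
Qed.

End Values.

Lemma free_field_place (X : choiceType) (F : unitAlgType rat)
    (iota : {lrmorphism freealg X -> F}) (h : X -> rat) :
    is_free_field iota ->
  exists (O : {pred F}) (nu : F -> (rat^o : unitAlgType rat)), place O nu /\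
    forall p, iota p \in O /\ nu (iota p) = substitute (h : X -> rat^o) p.
Proof.
pose mu : {lrmorphism freealg X -> (rat^o : unitAlgType rat)} :=
  substitute (h : X -> rat^o).
case=> _ _ _ /(_ _ mu) []; first by move=> x; rewrite unitfE.
move=> O [nu ext]; exists O, nu; split; first exact: extends_to_place ext.
by case: ext.
Qed.

Lemma lrmorph_substitute (X : choiceType) (A B : lalgType rat)
    (f : {lrmorphism A -> B}) (h : X -> A) (p : freealg X) :
  f (substitute h p) = substitute (f \o h) p.
Proof.
rewrite /substitute !mmapE raddf_sum; apply: eq_bigr => w _.
by rewrite /= rmorphM /= linearZ /= rmorph1 rmorph_prod.
Qed.

Lemma stoch_letter_row_sum n (i : 'I_n) :
  \sum_j stoch_letter ((i, j) : letter n) = 1.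
Proof.
rewrite (bigD1 i) //= {1}/stoch_letter eqxx.
under [X in _ + X]eq_bigr => j ij do rewrite /stoch_letter /= eq_sym (negbTE ij).
by rewrite subrK.
Qed.

Lemma substitute_stoch_const n (i j : 'I_n) :
  substitute (fun=> n%:R^-1 : rat^o) (stoch_letter ((i, j) : letter n)) = n%:R^-1.
Proof.
pose ev : {lrmorphism freealg (offdiag_letter n) -> rat^o} :=
  substitute (fun=> n%:R^-1 : rat^o).
rewrite -[LHS]/(ev _).
have off k l : k != l -> ev (stoch_letter ((k, l) : letter n)) = n%:R^-1.
  move=> kl; rewrite /stoch_letter /= (negbTE kl) /stoch_offdiag insubT.
  exact: substitute_var.
have [<-{j}|] := eqVneq i j; last exact: off.
(* The diagonal entry is forced: the row sums to 1 and its other [n - 1] entries are [1/n]. *)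
have := congr1 ev (stoch_letter_row_sum i); rewrite raddf_sum rmorph1 (bigD1 i) //=.
rewrite (eq_bigr (fun=> n%:R^-1)) => [|k]; last by rewrite eq_sym; apply: off.
have n0 : n%:R != 0 :> rat.
  by rewrite Num.Theory.pnatr_eq0 -lt0n (leq_trans _ (ltn_ord i)).
have : \sum_(k < n) n%:R^-1 = 1 :> rat.
  by rewrite sumr_const card_ord -(mulr_natr n%:R^-1) mulVf.
by rewrite (bigD1 i) //= => h1 h2; apply: (addIr _ (etrans h2 (esym h1))).
Qed.

Lemma pivots_nonzero n (i : 'I_n) k : (k <= size (others i))%N ->
  1 - k%:R * n%:R^-1 != 0 :> rat.
Proof.
move=> le_k; have lt_k : (k < n)%N.
  by rewrite (leq_ltn_trans le_k) // -[X in (_ < X)%N]card_ord size_others.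
have n0 : n%:R != 0 :> rat by rewrite Num.Theory.pnatr_eq0 -lt0n (leq_ltn_trans _ lt_k).
rewrite subr_eq0 -(inj_eq (mulIf n0)) mul1r mulfVK // Num.Theory.eqr_nat.
by rewrite neq_ltn lt_k orbT.
Qed.

Theorem theorem1 (n : nat) (n_gt0 : (0 < n)%N)
  (F : unitAlgType rat) (iF : {lrmorphism freealg (letter n) -> F})
  (freeF : is_free_field iF)
  (Sf : unitAlgType rat) (iS : {lrmorphism freealg (offdiag_letter n) -> Sf})
  (freeS : is_free_field iS)
  (lam : F -> F) (lam_der : derivation lam)
  (lam_a : forall i j : 'I_n, lam (iF (a i j)) = iF (a i j)) :
  let sigma : freealg (letter n) -> Sf := fun p => iS (stoch p) in
  let Smx : 'M[Sf]_n := \matrix_(i, j) sigma (a i j) in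
  let C i : F := embed_series iF (C_series i) in
  let P i : F := embed_series iF (P_series i) in
  let val_S (f : F) : Sf := value iF sigma f in
  let v : 'rV[Sf]_n := \row_i (val_S (P i))^-1 in
  (forall i, evaluable iF sigma (P i) /\ val_S (P i) != 0) /\
  v *m Smx = v /\
  \sum_(i < n) (val_S (P i))^-1 = 1 /\
  (forall i, evaluable iF sigma (C i) /\ val_S (C i) = 1) /\
  (forall i, evaluable iF sigma (lam (C i)) /\ val_S (lam (C i)) = val_S (P i)).
Proof.
pose mu : {lrmorphism freealg (letter n) -> Sf} := substitute (iS \o @stoch_letter n).
move=> sigma; have {sigma}-> : sigma = mu.
  by apply/funext => p; apply: lrmorph_substitute.
move=> Smx C P val_S v.
have [skewF _ _ _] := freeF; have [skewS _ _ _] := freeS.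
pose AF i j := iF (a i j); pose AS i j := mu (a i j).
have ASE i j : AS i j = iS (stoch_letter ((i, j) : letter n)) by apply: substitute_var.
(* Specialization at 0 puts the letters in the maximal ideal, as the uniqueness of series values
   requires, and makes each pivot in the free field specialize to 1. *)
have [OF [nuF [plF nuFE]]] := free_field_place (fun=> 0) freeF.
have nu_var x : iF (var x) \in OF /\ nuF (iF (var x)) = 0.
  by have [? ->] := nuFE (var x); rewrite substitute_var.
have pivF i : pivots_unit AF (others i).
  have [|//] := place_path_sum skewF plF (fun i j => nu_var (i, j)) (L := others i).
  by move=> k _; rewrite mulr0 subr0 oner_eq0.
(* Only off-diagonal letters are specialized to [1/n]; the diagonal entries then also become
   [1/n]. *)
have [OS [nuS [plS nuSE]]] := free_field_place (fun=> n%:R^-1) freeS.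
have nuAS i j : AS i j \in OS /\ nuS (AS i j) = n%:R^-1.
  rewrite ASE; have [? ->] := nuSE (stoch_letter (i, j)).
  by rewrite substitute_stoch_const.
have sumS i := place_path_sum skewS plS nuAS (@pivots_nonzero n i).
have pivS i : pivots_unit AS (others i) by case: (sumS i).
have AS1 i : \sum_j AS i j = 1.
  under eq_bigr => j _ do rewrite ASE.
  by rewrite -raddf_sum stoch_letter_row_sum /= rmorph1.
have unitP i : escape_sum AS i \is a GRing.unit.
  (* [P_i] specializes to a sum of [n] copies of the nonzero rational [x]. *)
  pose x := n%:R^-1 / (1 - (size (others i))%:R * n%:R^-1) : rat.
  have sumx j : path_sum AS (others i) i j \in OS /\
      nuS (path_sum AS (others i) i j) = x.
    by have [_] := sumS i; apply.
  have [OE nuE] : escape_sum AS i \in OS /\ nuS (escape_sum AS i) = \sum_(j < n) x.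
    rewrite (escape_sumE AS1 pivS).
    apply: (big_ind2 (fun u y => u \in OS /\ nuS u = y)) => //.
      by split; [exact: (place_0 plS) | exact: (nu0 plS)].
    move=> u y u' y' [Ou <-] [Ou' <-].
    by split; [exact: (place_D plS) | exact: (nuD plS)].
  apply: (place_unit skewS plS OE); rewrite nuE sumr_const card_ord -(mulr_natr x).
  have n0 : n%:R != 0 :> rat by rewrite Num.Theory.pnatr_eq0 -lt0n.
  apply: (mulf_neq0 (_ : x != 0) n0).
  by apply: mulf_neq0; apply: invr_neq0 => //; apply: (@pivots_nonzero n i).
have CE i : C i = return_sum AF i.
  apply: (embed_seriesE skewF plF nu_var); exists (path_expr (others i) i i).
  split; [exact: path_expr_wf | | exact: computes_path_sum (pivF i)].
  by move=> w; rewrite path_exprE ?others_uniq // C_seriesE.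
have PE i : P i = escape_sum AF i.
  apply: (embed_seriesE skewF plF nu_var); exists (escape_expr i).
  by split; [exact: escape_expr_wf | exact: P_seriesE
           | exact: computes_escape_sum (pivF i)].
have evC i : evaluates_to iF mu (C i) 1.
  rewrite -(return_sumE AS1 pivS i) CE; exists (star_rexpr (path_expr (others i) i i)).
  by split; [apply: computes_path_sum (pivF i)
           | apply: computes_path_sum (pivS i)].
have evP i : evaluates_to iF mu (P i) (escape_sum AS i).
  rewrite PE; exists (star_rexpr (escape_expr i)).
  by split; [apply: computes_escape_sum (pivF i)
           | apply: computes_escape_sum (pivS i)].
have evlC i : evaluates_to iF mu (lam (C i)) (escape_sum AS i).
  (* The derivation acts only in the free field. There it yields the formal derivative of [C_i],
     whose expression is then computed in the stochastic free field, where it equals [P_i]. *)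
  rewrite -(return_deriv AS1 pivS i) CE (derivation_path_sum _ _ lam_der lam_a) //.
  exists (path_deriv_expr (others i) i i).
  by split; [apply: computes_path_sum_deriv (pivF i)
           | apply: computes_path_sum_deriv (pivS i)].
have valP i : val_S (P i) = escape_sum AS i by apply: valueE (evP i).
split; first by move=> i; split; [exists (escape_sum AS i) | rewrite valP;
  apply: contraTneq (unitP i) => ->; rewrite unitr0].
split; first apply/rowP => j.
  rewrite !mxE valP -(escape_sumV_fixed AS1 pivS unitP).
  by apply: eq_bigr => i _; rewrite !mxE valP.
split.
  under eq_bigr => i _ do rewrite valP.
  exact: (sum_escape_sumV AS1 pivS unitP (Ordinal n_gt0)).
split=> i; first by split; [exists 1 | apply: valueE (evC i)].
by split; [exists (escape_sum AS i) | rewrite valP; apply: valueE (evlC i)].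
Qed.
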